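(* For all non-zero integers $m$ and $n$, the Baumslag–Solitar group $BS(m,n)=\langle a,b\mid ab^ma^{-1}=b^n\rangle$ is inner amenable.
   Context: For a group $G$, put $G^*=G\setminus\{1\}$. A (discrete, countable) group $G$ is inner amenable if $G=\{1\}$ or if there is a linear form $\mu:\ell^\infty(G^* )\to\mathbb{C}$ that is positive ($\mu(f)\geqslant0$ whenever $f\geqslant 0$), normalized ($\mu(1)=1$), and invariant under inner automorphisms: $\mu(f\circ g^{-1})=\mu(f)$ for all $g\in G$ and $f\in\ell^\infty(G^* )$, where $g$ also denotes the map $x\mapsto gxg^{-1}$ on $G^*$. *)

(* Defs.v *)
From HB Require Import structures.
From mathcomp Require Import all_boot all_order all_algebra.
From mathcomp Require Import generic_quotient.
From mathcomp Require Import complex.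
From mathcomp Require Import all_classical all_reals all_analysis.

Set Implicit Arguments.
Unset Strict Implicit.
Unset Printing Implicit Defensive.

Import Order.TTheory GRing.Theory Num.Theory.
Import numFieldNormedType.Exports.

Local Open Scope quotient_scope.

(* Groups given by generators and relations: words in letters x (encoded as    *)
(* (x, true)) and x^-1 (encoded as (x, false)), modulo the congruence          *)
(* generated by free cancellation and by the defining relations.               *)

Definition word (X : Type) : Type := seq (X * bool).

Definition wlet {X : Type} (x : X) : word X := [:: (x, true)].

Definition winv {X : Type} (w : word X) : word X :=
  rev [seq (l.1, ~~ l.2) | l <- w].

Definition wexp {X : Type} (w : word X) (k : int) : word X :=
  match k with
  | Posz p => iter p (cat w) [::]
  | Negz p => iter p.+1 (cat (winv w)) [::]
  end.

Section Presentation.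
Variables (X : countType) (rels : word X -> word X -> Prop).

Inductive wcongr : word X -> word X -> Prop :=
| wcongr_rel u v : rels u v -> wcongr u v
| wcongr_cancel x e : wcongr [:: (x, e); (x, ~~ e)] [::]
| wcongr_refl u : wcongr u u
| wcongr_sym u v : wcongr u v -> wcongr v u
| wcongr_trans v u w : wcongr u v -> wcongr v w -> wcongr u w
| wcongr_cat u u' v v' :
    wcongr u u' -> wcongr v v' -> wcongr (u ++ v) (u' ++ v').

Definition wcongrb : rel (seq (X * bool)) := fun u v => `[< wcongr u v >].

Lemma wcongrb_refl : reflexive wcongrb.
Proof. by move=> u; apply/asboolP; exact: wcongr_refl. Qed.

Lemma wcongrb_sym : symmetric wcongrb.
Proof. by move=> u v; apply/asboolP/asboolP; exact: wcongr_sym. Qed.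

Lemma wcongrb_trans : transitive wcongrb.
Proof.
move=> v u w /asboolP uv /asboolP vw; apply/asboolP; exact: wcongr_trans uv vw.
Qed.

Canonical wcongrb_equiv := EquivRel wcongrb wcongrb_refl wcongrb_sym wcongrb_trans.

Definition presented : Type := {eq_quot wcongrb}.

HB.instance Definition _ := Countable.on presented.
HB.instance Definition _ := EqQuotient.on presented.

Definition pclass (w : word X) : presented := \pi_presented w.

Lemma pclassP u v : pclass u = pclass v <-> wcongr u v.
Proof.
split; first by move=> /eqmodP/asboolP.
by move=> uv; apply/eqmodP/asboolP.
Qed.

Lemma pclass_repr x : pclass (repr x) = x.
Proof. exact: reprK. Qed.

Lemma wcongr_repr w : wcongr (repr (pclass w)) w.
Proof. by apply/pclassP; rewrite pclass_repr. Qed.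

Definition pone : presented := pclass [::].
Definition pmul (x y : presented) : presented := pclass (repr x ++ repr y).
Definition pinv (x : presented) : presented := pclass (winv (repr x)).

Lemma pmulE u v : pmul (pclass u) (pclass v) = pclass (u ++ v).
Proof. by apply/pclassP; apply: wcongr_cat; exact: wcongr_repr. Qed.

Lemma winv_cat (u v : word X) : winv (u ++ v) = winv v ++ winv u.
Proof. by rewrite /winv map_cat rev_cat. Qed.

Lemma winvK : involutive (@winv X).
Proof.
move=> w; rewrite /winv map_rev revK -map_comp -[RHS]map_id.
by apply: eq_map => -[x e] /=; rewrite negbK.
Qed.

Lemma wcongr_catV w : wcongr (w ++ winv w) [::].
Proof.
elim: w => [|[x e] w IHw]; first exact: wcongr_refl.
rewrite -cat1s winv_cat catA -(catA _ w).
apply: wcongr_trans (wcongr_cancel x e); rewrite -[X in wcongr _ X]cat1s.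
apply: wcongr_cat; last exact: wcongr_refl.
rewrite -[X in wcongr _ X]cats0; apply: wcongr_cat => //; exact: wcongr_refl.
Qed.

Lemma wcongr_catVl w : wcongr (winv w ++ w) [::].
Proof. by rewrite -{2}(winvK w); exact: wcongr_catV. Qed.

Lemma pmulA : associative pmul.
Proof.
move=> x y z; rewrite -(pclass_repr x) -(pclass_repr y) -(pclass_repr z).
by rewrite !pmulE catA.
Qed.

Lemma pmul1 : left_id pone pmul.
Proof. by move=> x; rewrite -(pclass_repr x) pmulE. Qed.

Lemma pmulr1 : right_id pone pmul.
Proof. by move=> x; rewrite -(pclass_repr x) pmulE cats0. Qed.

Lemma pmulV : left_inverse pone pinv pmul.
Proof.
move=> x; rewrite /pinv -{2}(pclass_repr x) pmulE.
by apply/pclassP; exact: wcongr_catVl.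
Qed.

Lemma pmulrV : right_inverse pone pinv pmul.
Proof.
move=> x; rewrite /pinv -{1}(pclass_repr x) pmulE.
by apply/pclassP; exact: wcongr_catV.
Qed.

HB.instance Definition _ :=
  isGroup.Build presented pmulA pmul1 pmulr1 pmulV pmulrV.

End Presentation.

Inductive BSgen : Type := BSa | BSb.

Definition BSgen_bool (x : BSgen) : bool := if x is BSa then true else false.
Definition bool_BSgen (e : bool) : BSgen := if e then BSa else BSb.

Lemma BSgen_boolK : cancel BSgen_bool bool_BSgen.
Proof. by case. Qed.

HB.instance Definition _ := Countable.copy BSgen (can_type BSgen_boolK).

(* The single relation a b^m a^-1 = b^n. *)
Definition BSrel (m n : int) (u v : word BSgen) : Prop :=
  u = wlet BSa ++ wexp (wlet BSb) m ++ winv (wlet BSa) /\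
  v = wexp (wlet BSb) n.

Definition BS (m n : int) : Type := presented (BSrel m n).

HB.instance Definition _ (m n : int) := Countable.on (BS m n).
HB.instance Definition _ (m n : int) := Group.on (BS m n).

Local Open Scope ring_scope.

Section Linf.
Variables (R : realType) (T : Type).

Definition linf_pred : {pred T -> R[i]} :=
  fun f => `[< bounded_fun (f : T -> R[i]^o) >].

Lemma linf_predP (f : T -> R[i]) :
  reflect (exists M : R[i], forall x, `|f x| <= M) (f \in linf_pred).
Proof.
apply: (iffP (asboolP _)) => [[M [Mreal /(_ (M + 1))]]|[M fM]].
  by rewrite ltrDl ltr01 => /(_ erefl) fM; exists (M + 1) => x; exact: fM.
have [[x]|T0] := pselect (inhabited T).
  have Mreal : M \is Num.real by rewrite ger0_real// (le_trans _ (fM x)).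
  by exists M; split=> // N MN y _ /=; exact: le_trans (fM y) (ltW MN).
by exists 0; split=> // N _ y; exfalso; apply: T0.
Qed.

Lemma linf_submod_closed : submod_closed linf_pred.
Proof.
split=> [|a f g /linf_predP[M fM] /linf_predP[N gN]]; apply/linf_predP.
  by exists 0 => x; rewrite normr0.
exists (`|a| * M + N) => x.
have -> : (a *: f + g) x = a * f x + g x by [].
by rewrite (le_trans (ler_normD _ _))// lerD// normrM ler_wpM2l.
Qed.

HB.instance Definition _ :=
  GRing.isSubmodClosed.Build R[i] (T -> R[i]) linf_pred linf_submod_closed.

Record linf : Type := Linf { linf_fun :> T -> R[i]; _ : linf_fun \in linf_pred }.

HB.instance Definition _ := [isSub for linf_fun].
HB.instance Definition _ := [Choice of linf by <:].
HB.instance Definition _ := [SubChoice_isSubLmodule of linf by <:].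

Lemma linf_cst_subproof (c : R[i]) : (fun _ : T => c) \in linf_pred.
Proof. by apply/linf_predP; exists `|c|. Qed.

Definition linf_cst (c : R[i]) : linf := Linf (linf_cst_subproof c).

Lemma linf_comp_subproof (f : linf) (h : T -> T) : (f \o h) \in linf_pred.
Proof.
by case: f => f /= /linf_predP[M fM]; apply/linf_predP; exists M => x /=.
Qed.

Definition linf_comp (f : linf) (h : T -> T) : linf :=
  Linf (linf_comp_subproof f h).

End Linf.

Section InnerAmenable.
Variables (R : realType) (G : groupType).
Local Open Scope group_scope.

Definition gstar : Type := {x : G | x != 1}.

Lemma inner_subproof (g : G) (x : gstar) : g * val x * g^-1 != 1.
Proof.
by apply: contra (valP x) => /eqP/divg1_eq gx; apply/eqP/(mulgI g); rewrite mulg1.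
Qed.

Definition inner (g : G) (x : gstar) : gstar :=
  exist _ (g * val x * g^-1) (inner_subproof g x).

Local Open Scope ring_scope.

(* The order on R[i] is the partial one, for which 0 <= z means that z is real *)
(* and nonnegative.                                                            *)
Definition invariant_mean (mu : {scalar linf R gstar}) : Prop :=
  [/\ forall f : linf R gstar, (forall x, 0 <= f x) -> 0 <= mu f,
      mu (linf_cst gstar 1) = 1
    & forall (g : G) (f : linf R gstar), mu (linf_comp f (inner g^-1%g)) = mu f].

Definition inner_amenable : Prop :=
  (forall x : G, x = 1%g) \/
  exists mu : {scalar linf R gstar}, invariant_mean mu.

End InnerAmenable.

(* Main.v *)
Require Import Defs.
From HB Require Import structures.
From mathcomp Require Import all_boot all_order all_algebra.
From mathcomp Require Import all_classical all_reals all_analysis.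
From mathcomp Require Import complex ring.

Set Implicit Arguments.
Unset Strict Implicit.
Unset Printing Implicit Defensive.

Import Order.TTheory GRing.Theory Num.Theory.
Import numFieldNormedType.Exports.

Local Open Scope classical_set_scope.
Local Open Scope ring_scope.

Local Notation Re := (@complex.Re _).
Local Notation Im := (@complex.Im _).

(** The mean lives on the nontrivial powers of [b]. Conjugation by [b] fixes
    them, and conjugation by [a] sends [b ^ (m k)] to [b ^ (n k)]. Hence, for
    each [N], conjugation by [a] moves one step down the chain
    [c_i = b ^ (m ^ i n ^ (N - i))], [0 <= i <= N]: it sends [c_(i+1)] to [c_i]
    ([inner_a_bpoint]). Averaging a bounded [f] over the chain therefore
    changes by at most [2 |f| / (N + 1)] when [f] is composed with this
    conjugation, since the sums telescope ([mean_shift]), and a limit of these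
    averages along a nonprincipal ultrafilter on [nat] is a mean invariant under
    conjugation by [a] and by [b], hence by the whole group ([pclass_ind]).
    The points of a chain need not be distinct, so the case [|m| = |n|] is
    not special.

    The averages live on nontrivial elements because [b] has infinite order
    ([bpow_neq1]): the group acts on the rational line with [b] acting by
    [x |-> x + 1] and [a] by [x |-> (n / m) x].

    The ultralimit is taken on bounded complex sequences, as a linear form on
    the bounded functions on [nat], so that the mean is its composite with the
    linear map sending [f] to its sequence of averages. *)

(** * Limits along an ultrafilter *)

Section Ultralimit.
Variables (R : realType) (U : set_system nat).
Hypotheses (UU : UltraFilter U) (ooU : \oo `<=` U).

(** The image of an ultrafilter clusters in a compact segment; since each
    preimage or its complement is in the ultrafilter, a cluster point is a
    limit. *)
Lemma ultra_cvg (u : nat -> R) (M : R) :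
  (forall k, `|u k| <= M) -> cvg (u @ U).
Proof.
move=> uM.
have uMU : (u @ U) `[- M, M]%classic.
  by apply: (@filterE _ U) => k /=; rewrite in_itv/= -ler_norml.
have [p [_ clp]] := @segment_compact R (- M) M (u @ U) _ uMU.
apply/cvg_ex; exists p => V Vp.
have [//|UV] := in_ultra_setVsetC (u @^-1` V) UU.
by have [x []] := clp (~` V) V UV Vp.
Qed.

Lemma le_Re_Im (z M : R[i]) : `|z| <= M ->
  `|Re z| <= Re M /\ `|Im z| <= Re M.
Proof.
move=> zM; split.
  by have := le_trans (normc_ge_Re z) zM; rewrite lecE/= => /andP[].
have i1 : `|'i%C| = 1 :> R[i] by rewrite normc_def/= expr0n expr1n/= add0r sqrtr1.
have := normc_ge_Re (z * 'i%C); rewrite ReiNIm normrN normrM i1 mulr1.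
by move=> /le_trans/(_ zM); rewrite lecE/= => /andP[].
Qed.

Lemma Re_ultra_cvg (u : linf R nat) : cvg (Re \o u @ U).
Proof.
have [M uM] := linf_predP _ (valP u).
by apply: (@ultra_cvg _ (Re M)) => k; have [] := le_Re_Im (uM k).
Qed.

Lemma Im_ultra_cvg (u : linf R nat) : cvg (Im \o u @ U).
Proof.
have [M uM] := linf_predP _ (valP u).
by apply: (@ultra_cvg _ (Re M)) => k; have [] := le_Re_Im (uM k).
Qed.

Definition ultralim (u : linf R nat) : R[i] :=
  Complex (lim (Re \o u @ U)) (lim (Im \o u @ U)).

Lemma ultralimP (u : linf R nat) (x y : R) :
  Re \o u @ U --> x -> Im \o u @ U --> y ->
  ultralim u = Complex x y.
Proof. by move=> ux uy; rewrite /ultralim (cvg_lim _ ux)// (cvg_lim _ uy). Qed.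

Lemma ultralim_is_scalar : scalar ultralim.
Proof.
case=> p q u v.
have ru := @Re_ultra_cvg u; have iu := @Im_ultra_cvg u.
have rv := @Re_ultra_cvg v; have iv := @Im_ultra_cvg v.
rewrite (@ultralimP _
  (p * lim (Re \o u @ U) - q * lim (Im \o u @ U)
     + lim (Re \o v @ U))
  (p * lim (Im \o u @ U) + q * lim (Re \o u @ U)
     + lim (Im \o v @ U))) //.
- have -> : Re \o (Complex p q *: u + v) =
      (fun k => p * (Re \o u) k - q * (Im \o u) k + (Re \o v) k).
    apply/funext => k; change (Re (Complex p q * u k + v k) = p * Re (u k) - q * Im (u k) + Re (v k)).
    by case: (u k) (v k) => [? ?] [? ?].
  apply: cvgD => //; apply: cvgB; exact: cvgMr.
- have -> : Im \o (Complex p q *: u + v) =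
      (fun k => p * (Im \o u) k + q * (Re \o u) k + (Im \o v) k).
    apply/funext => k; change (Im (Complex p q * u k + v k) = p * Im (u k) + q * Re (u k) + Im (v k)).
    by case: (u k) (v k) => [? ?] [? ?].
  apply: cvgD => //; apply: cvgD; exact: cvgMr.
Qed.

HB.instance Definition _ :=
  GRing.isLinear.Build R[i] (linf R nat) R[i] *%R ultralim ultralim_is_scalar.

Lemma ultralim_cst (c : R[i]) : ultralim (linf_cst nat c) = c.
Proof. by case: c => x y; apply: ultralimP; exact: cvg_cst. Qed.

Lemma ultralim_ge0 (u : linf R nat) : (forall k, 0 <= u k) -> 0 <= ultralim u.
Proof.
move=> u0; have ri k : Im (u k) = 0 /\ 0 <= Re (u k).
  by have := u0 k; rewrite lecE/= => /andP[/eqP].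
rewrite lecE/=; apply/andP; split.
  rewrite (_ : Im \o u = cst 0) ?lim_cst//.
  by apply/funext => k /=; have [] := ri k.
apply: limr_ge; first exact: Re_ultra_cvg.
by apply: nearW => k /=; have [] := ri k.
Qed.

(** The only place where the ultrafilter has to be nonprincipal: it refines the
    cofinite filter, so an ordinary limit is an ultralimit. *)
Lemma ultralim_null (u : linf R nat) (C : R[i]) :
  (forall k, `|u k| <= C / k.+1%:R) -> ultralim u = 0.
Proof.
move=> uC; have cvg0 (v : nat -> R) :
    (forall k, `|v k| <= Re C / k.+1%:R) -> v @ U --> (0 : R).
  move=> vC; apply: cvg_trans (_ : v @ \oo --> (0 : R)).
    by move=> A /= oA; exact: ooU.
  have cC : (fun k => Re C / k.+1%:R) @ \oo --> (0 : R).
    by rewrite -[X in _ --> X](mulr0 (Re C)); apply: cvgMr; exact: cvg_harmonic.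
  apply: (@squeeze_cvgr _ _ _ _ (fun k => - (Re C / k.+1%:R)) _ _ _ _ _ cC).
    by apply: nearW => k; rewrite -ler_norml.
  by rewrite -[X in _ --> X]oppr0; exact: cvgN.
have CE k : Re (C / k.+1%:R) = Re C / k.+1%:R.
  rewrite -[X in _ = _ / X]/(k.+1%:R : R) -(rmorph_nat (real_complex R)) -fmorphV.
  by case: (C) => x y /=; rewrite mulr0 subr0.
apply: ultralimP; apply: cvg0 => k; have [leRe leIm] := le_Re_Im (uC k).
  by rewrite -CE.
by rewrite -CE.
Qed.

End Ultralimit.

(** * Means along averages *)

Section Mean.
Variables (R : realType) (T : Type) (p : nat -> nat -> T).

Definition averages_fun (f : T -> R[i]) (N : nat) : R[i] :=
  (\sum_(i < N.+1) f (p N i)) / N.+1%:R.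

Lemma averages_subproof (f : linf R T) : averages_fun f \in @linf_pred R nat.
Proof.
case: f => f /= /linf_predP[M fM]; apply/linf_predP; exists M => N.
rewrite normrM normfV normr_nat ler_pdivrMr ?ltr0n//.
apply: (@le_trans _ _ (\sum_(i < N.+1) `|f (p N i)|)); first exact: ler_norm_sum.
rewrite mulr_natr -[in leRHS](card_ord N.+1) -sumr_const.
by apply: ler_sum => i _.
Qed.

Definition averages (f : linf R T) : linf R nat := Linf (averages_subproof f).

Variables (U : set_system nat).
Hypotheses (UU : UltraFilter U) (ooU : \oo `<=` U).

Definition mean (f : linf R T) : R[i] := ultralim U (averages f).

Lemma mean_is_scalar : scalar mean.
Proof.
move=> a f g; rewrite /mean -(ultralim_is_scalar UU); congr ultralim.
apply: val_inj; apply/funext => N /=.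
transitivity (a * averages_fun f N + averages_fun g N); last by [].
rewrite /averages_fun mulrA -mulrDl mulr_sumr -big_split/=.
by congr (_ / _); apply: eq_bigr.
Qed.

HB.instance Definition _ :=
  GRing.isLinear.Build R[i] (linf R T) R[i] *%R mean mean_is_scalar.

Lemma mean_ge0 (f : linf R T) : (forall x, 0 <= f x) -> 0 <= mean f.
Proof.
move=> f0; apply: ultralim_ge0 => // N /=.
by rewrite divr_ge0// sumr_ge0.
Qed.

Lemma mean1 : mean (linf_cst T 1) = 1.
Proof.
rewrite -[RHS](ultralim_cst UU); congr ultralim; apply: val_inj; apply/funext => N /=.
by rewrite /averages_fun/= sumr_const card_ord divff// pnatr_eq0.
Qed.

Lemma mean_fixed (h : T -> T) (f : linf R T) :
  (forall N i, h (p N i) = p N i) -> mean (linf_comp f h) = mean f.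
Proof.
move=> hp; congr ultralim; apply: val_inj; apply/funext => N /=.
by rewrite /averages_fun; congr (_ / _); apply: eq_bigr => i _ /=; rewrite hp.
Qed.

(** The two averages telescope to [(f (h (p N 0)) - f (p N N)) / (N + 1)], whatever
    [h] does to the lowest point [p N 0]. *)
Lemma mean_shift (h : T -> T) (f : linf R T) :
  (forall N i, (i < N)%N -> h (p N i.+1) = p N i) ->
  mean (linf_comp f h) = mean f.
Proof.
move=> hp; apply/eqP; rewrite -subr_eq0; apply/eqP.
rewrite -scaleN1r addrC -mean_is_scalar.
have [M fM] := linf_predP _ (valP f).
apply: (ultralim_null UU ooU (C := M + M)) => N.
have -> : averages (-1 *: f + linf_comp f h) N =
    (f (h (p N 0)) - f (p N N)) / N.+1%:R.
  congr (_ / _).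
  transitivity (\sum_(i < N.+1) (f (h (p N i)) - f (p N i))).
    apply: eq_bigr => i _.
    change (-1 * f (p N i) + f (h (p N i)) = f (h (p N i)) - f (p N i)).
    by rewrite mulN1r addrC.
  rewrite sumrB big_ord_recl [in X in _ - X]big_ord_recr/=.
  rewrite (eq_bigr (fun i : 'I_N => f (p N i))); last first.
    by move=> i _; rewrite hp.
  by rewrite opprD addrA addrK.
rewrite normrM normfV normr_nat ler_pM2r ?invr_gt0 ?ltr0n//.
apply: (@le_trans _ _ (`|f (h (p N 0%N))| + `|f (p N N)|)); first exact: ler_normB.
by apply: lerD; exact: fM.
Qed.

End Mean.

(** * Inner invariance of a functional *)

Section InnerInvariance.
Variables (R : realType) (G : groupType) (mu : linf R (gstar G) -> R[i]).
Local Open Scope group_scope.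

Definition inner_invariant (g : G) : Prop :=
  forall f : linf R (gstar G), mu (linf_comp f (inner g)) = mu f.

Lemma linf_comp_inner1 (f : linf R (gstar G)) : linf_comp f (inner 1) = f.
Proof.
apply: val_inj; apply/funext => x /=; congr (linf_fun f _).
by apply: val_inj; rewrite /= mul1g invg1 mulg1.
Qed.

Lemma linf_comp_innerM (g h : G) (f : linf R (gstar G)) :
  linf_comp f (inner (g * h)) = linf_comp (linf_comp f (inner g)) (inner h).
Proof.
apply: val_inj; apply/funext => x /=; congr (linf_fun f _).
by apply: val_inj; rewrite /= invgM !mulgA.
Qed.

Lemma inner_invariant1 : inner_invariant 1.
Proof. by move=> f; rewrite linf_comp_inner1. Qed.

Lemma inner_invariantM (g h : G) :
  inner_invariant g -> inner_invariant h -> inner_invariant (g * h).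
Proof. by move=> gi hi f; rewrite linf_comp_innerM hi gi. Qed.

Lemma inner_invariantV (g : G) : inner_invariant g -> inner_invariant g^-1.
Proof.
move=> gi f; rewrite -gi -linf_comp_innerM mulVg.
by rewrite linf_comp_inner1.
Qed.

End InnerInvariance.

(** * Powers in groups given by generators and relations *)

Section IntegerPower.
Variable G : groupType.
Local Open Scope group_scope.

Definition expgz (x : G) (k : int) : G :=
  match k with Posz p => x ^+ p | Negz p => x ^- p.+1 end.

Lemma expgzN (x : G) (k : int) : expgz x (- k)%R = (expgz x k)^-1.
Proof.
by case: k => [[|p]|p] //=; rewrite ?expg0 ?invg1// invgK.
Qed.

Lemma expgzM (x : G) (k l : int) : expgz x (k * l)%R = expgz (expgz x k) l.
Proof.
have pos (q : nat) : expgz x (k * q%:Z)%R = expgz x k ^+ q.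
  case: k => p; first by rewrite -PoszM /= expgnA.
  by rewrite NegzE mulNr -PoszM !expgzN expVgn; congr _^-1; exact: expgnA.
case: l => q; first exact: pos.
by rewrite NegzE mulrN !expgzN pos.
Qed.

Lemma expgz_conj (x y : G) (k : int) : y * expgz x k * y^-1 = expgz (y * x * y^-1) k.
Proof.
have conjE z : y * z * y^-1 = z ^ y^-1 by rewrite conjgE invgK mulgA.
by rewrite !conjE; case: k => p /=; rewrite ?conjVg conjXg.
Qed.

End IntegerPower.

Section PresentedPower.
Variables (X : countType) (rels : word X -> word X -> Prop).
Local Open Scope group_scope.

Lemma pclass_cat (u v : word X) :
  pclass rels (u ++ v) = pclass rels u * pclass rels v.
Proof. by rewrite -pmulE. Qed.

Lemma pclass_inv (w : word X) : pclass rels (winv w) = (pclass rels w)^-1.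
Proof.
apply: (mulIg (pclass rels w)); rewrite mulVg -pclass_cat.
by apply/pclassP; exact: wcongr_catVl.
Qed.

Lemma pclass_exp (w : word X) (k : int) :
  pclass rels (wexp w k) = expgz (pclass rels w) k.
Proof.
have pos (v : word X) (p : nat) :
    pclass rels (iter p (cat v) [::]) = pclass rels v ^+ p.
  by elim: p => [|p IHp] //=; rewrite pclass_cat IHp expgS.
by case: k => p; rewrite pos//= pclass_inv expVgn.
Qed.

(** A presented group is generated by its letters, so that inner invariance has
    to be checked on these only. *)
Lemma pclass_ind (P : presented rels -> Prop) :
  P 1 -> (forall g h, P g -> P h -> P (g * h)) -> (forall g, P g -> P g^-1) ->
  (forall x, P (pclass rels (wlet x))) -> forall g, P g.
Proof.
move=> P1 PM PV Pl g; rewrite -(pclass_repr g); elim: (repr g) => [//|[x e] w IHw].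
rewrite -cat1s pclass_cat; apply: PM => //.
case: e; first exact: Pl.
rewrite (_ : [:: _] = winv (wlet x))// pclass_inv; exact: PV.
Qed.

End PresentedPower.

(** * The Baumslag-Solitar groups *)

Section BaumslagSolitar.
Variables (m n : int).
Hypotheses (m0 : m != 0) (n0 : n != 0).

(** The affine action on the rational line, which separates the powers of [b]. *)
Definition affine_letter (l : BSgen * bool) (x : rat) : rat :=
  match l with
  | (BSa, true) => n%:~R / m%:~R * x
  | (BSa, false) => m%:~R / n%:~R * x
  | (BSb, true) => x + 1
  | (BSb, false) => x - 1
  end.

Definition affine (w : word BSgen) (x : rat) : rat := foldr affine_letter x w.

Lemma affine_cat (u v : word BSgen) x : affine (u ++ v) x = affine u (affine v x).
Proof. exact: foldr_cat. Qed.

Lemma affine_exp (k : int) x : affine (wexp (wlet BSb) k) x = x + k%:~R.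
Proof.
case: k => p; rewrite /wexp.
  elim: p => [|p IHp]; first by rewrite addr0.
  by rewrite iterS affine_cat IHp /= -addrA -[p.+1]addn1 PoszD rmorphD.
rewrite NegzE; elim: {p}p.+1 => [|p IHp]; first by rewrite /= oppr0 addr0.
by rewrite iterS affine_cat IHp /= -addrA -[p.+1]addn1 PoszD opprD rmorphD.
Qed.

Lemma affine_congr (u v : word BSgen) :
  wcongr (BSrel m n) u v -> affine u =1 affine v.
Proof.
have [mQ nQ] : (m%:~R : rat) != 0 /\ (n%:~R : rat) != 0 by rewrite !intr_eq0.
elim=> {u v} [u v [-> ->]|[] []|u|u v _ IH|v u w _ IHu _ IHv|u u' v v' _ IHu _ IHv] x.
- rewrite !affine_cat !affine_exp /=.
  by field; rewrite mQ nQ.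
- by rewrite /=; field; rewrite mQ nQ.
- by rewrite /=; field; rewrite mQ nQ.
- by rewrite /=; ring.
- by rewrite /=; ring.
- by [].
- by rewrite IH.
- by rewrite IHu IHv.
- by rewrite !affine_cat IHu IHv.
Qed.

Local Notation gen x := (pclass (BSrel m n) (wlet x) : BS m n).
Local Notation bpow k := (expgz (gen BSb) k).

Lemma bpow_neq1 (k : int) : k != 0 -> bpow k != 1%g.
Proof.
apply: contraNneq => /esym; rewrite -pclass_exp => /pclassP/affine_congr/(_ 0).
by rewrite affine_exp add0r => /esym/eqP; rewrite intr_eq0.
Qed.

Lemma gen_rel : (gen BSa * bpow m * (gen BSa)^-1)%g = bpow n.
Proof.
rewrite -!pclass_exp -pclass_inv -[X in (X * _)%g]pclass_cat -pclass_cat -catA; apply/pclassP.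
by apply: wcongr_rel; split.
Qed.

(** Conjugation is a morphism, so the defining relation passes to [k]-th
    powers. *)
Lemma bpow_shift (k : int) :
  (gen BSa * bpow (m * k) * (gen BSa)^-1)%g = bpow (n * k).
Proof.
by rewrite !expgzM expgz_conj gen_rel.
Qed.

(** Lowering [i] by one replaces one factor [m] by [n], as conjugation by [a] does
    on exponents. *)
Definition bexp (N i : nat) : int := m ^+ i * n ^+ (N - i).

Lemma bexp_neq0 N i : bexp N i != 0.
Proof. by rewrite mulf_neq0// expf_neq0. Qed.

Definition bpoint (N i : nat) : gstar (BS m n) :=
  exist _ (bpow (bexp N i)) (bpow_neq1 (bexp_neq0 N i)).

Lemma inner_a_bpoint N i : (i < N)%N ->
  inner (gen BSa) (bpoint N i.+1) = bpoint N i.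
Proof.
move=> iN; apply: val_inj => /=.
rewrite (_ : bexp N i.+1 = m * (m ^+ i * n ^+ (N - i.+1))); last first.
  by rewrite /bexp exprS mulrA.
rewrite bpow_shift; congr (expgz _ _).
by rewrite /bexp mulrCA -exprS subnSK.
Qed.

Lemma inner_b_bpoint N i : inner (gen BSb) (bpoint N i) = bpoint N i.
Proof.
by apply: val_inj; rewrite /= expgz_conj mulgK.
Qed.

End BaumslagSolitar.

Theorem mainTheorem5 (R : realType) (m n : int) (hm : (m != 0)%R) (hn : (n != 0)%R) :
  inner_amenable R (BS m n).
Proof.
have [U [UU ooU]] := ultraFilterLemma eventually_filter.
right; exists (mean (bpoint hm hn) U).
split=> [f f0| |g f].
- exact: mean_ge0.
- exact: mean1.
- suff inv : forall h, inner_invariant (mean (R := R) (bpoint hm hn) U) h.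
    exact: inv.
  apply: pclass_ind.
  + exact: inner_invariant1.
  + exact: inner_invariantM.
  + exact: inner_invariantV.
  + case=> h.
    * by apply: mean_shift => // N i; exact: inner_a_bpoint.
    * by apply: mean_fixed => N i; exact: inner_b_bpoint.
Qed.
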